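(* Let $(X,d)$ be a pseudometric space. Then the map $d^*\colon (X/{\equiv})^2\to\mathbb{R}$ given by $d^*(\eta(x),\eta(y))=d(x,y)$ for all $x,y\in X$ is (well-defined and) a metric on $X/{\equiv}$ that determines the same topology on $X/{\equiv}$ as the quotient map $\eta$.
   Context: A pseudometric on a set $X$ is a map $d\colon X^2\to\mathbb{R}$ with $d(x,y)\ge 0$, $d(x,x)=0$, $d(x,y)=d(y,x)$ and $d(x,z)\le d(x,y)+d(y,z)$ for all $x,y,z\in X$; it is a metric if moreover $d(x,y)=0$ implies $x=y$. The pseudometric space $(X,d)$ carries the topology with basis the open balls $B(x,r)=\{y\in X\mid d(x,y)<r\}$, $x\in X$, $r>0$. Points $x,y$ of a topological space $X$ are topologically indistinguishable, $x\equiv y$, if every open set containing $x$ contains $y$ and vice versa; this is an equivalence relation. The Kolmogorov quotient $X/{\equiv}$ is the set of equivalence classes $\eta(x)=\{y\in X\mid y\equiv x\}$; the topology determined by the quotient map $\eta\colon X\to X/{\equiv}$ is the quotient topology, in which a set is open if and only if its preimage under $\eta$ is open in $X$. *)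

(* Defs.v *)
From HB Require Import structures.
From mathcomp Require Import all_boot all_order all_algebra.
From mathcomp Require Import all_classical all_reals topology.

Set Implicit Arguments.
Unset Strict Implicit.
Unset Printing Implicit Defensive.

Import Order.TTheory GRing.Theory Num.Theory.
Local Open Scope classical_set_scope.
Local Open Scope ring_scope.
Local Open Scope quotient_scope.

Record is_pseudometric (R : realType) (X : Type) (d : X -> X -> R) : Prop := {
  pseudometric_ge0 : forall x y, 0 <= d x y ;
  pseudometric_xx : forall x, d x x = 0 ;
  pseudometric_sym : forall x y, d x y = d y x ;
  pseudometric_triangle : forall x y z, d x z <= d x y + d y z }.

Definition is_metric (R : realType) (X : Type) (d : X -> X -> R) : Prop :=
  is_pseudometric d /\ forall x y, d x y = 0 -> x = y.

Definition dball (R : realType) (X : Type) (d : X -> X -> R) (x : X) (r : R) :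
  set X := [set y | d x y < r].

Definition dballs (R : realType) (X : Type) (d : X -> X -> R) : set (set X) :=
  [set B | exists x r, 0 < r /\ B = dball d x r].

(* [pmspace pd] is an alias of [X] that carries the topology with basis the
   open balls of [d].  The classical choice structure is only there because
   [topologicalType] inherits from [choiceType]. *)
Definition pmspace (R : realType) (X : Type) (d : X -> X -> R)
  (pd : is_pseudometric d) : Type := X.

Section PseudometricTopology.
Variables (R : realType) (X : Type) (d : X -> X -> R).
Variable pd : is_pseudometric d.

HB.instance Definition _ := gen_eqMixin (pmspace pd).
HB.instance Definition _ := gen_choiceMixin (pmspace pd).

Lemma dballs_cover :
  \bigcup_(B in dballs d) (id B : set (pmspace pd)) = setT.
Proof.
apply/seteqP; split=> // x _; exists (dball d x 1).
  by exists x, 1; split.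
by rewrite /= /dball /= (pseudometric_xx pd).
Qed.

Lemma dballs_join (B C : set X) (t : X) : dballs d B -> dballs d C ->
  B t -> C t -> exists D, [/\ dballs d D, D t & D `<=` B `&` C].
Proof.
move=> [x [r [r0 ->]]] [y [s [s0 ->]]]; rewrite /dball /= => xt yt.
exists (dball d t (Num.min (r - d x t) (s - d y t))); split.
- by exists t, (Num.min (r - d x t) (s - d y t)); rewrite lt_min !subr_gt0 xt yt.
- by rewrite /dball /= (pseudometric_xx pd) lt_min !subr_gt0 xt yt.
- move=> z; rewrite /dball /= lt_min !ltrBrDl => /andP[xz yz].
  by split; apply: le_lt_trans (pseudometric_triangle pd _ t _) _.
Qed.

HB.instance Definition _ :=
  @isBaseTopological.Build (pmspace pd) (set X) (dballs d) id
    dballs_cover dballs_join.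

Definition pseudometric_open (U : set X) : Prop := @open (pmspace pd) U.

End PseudometricTopology.

Definition indistinguishable (T : topologicalType) (x y : T) : Prop :=
  forall U : set T, open U -> (U x <-> U y).

Section KolmogorovQuotient.
Variable T : topologicalType.

Definition indistinguishable_rel : rel T :=
  fun x y => `[< indistinguishable x y >].

Lemma indistinguishable_refl : reflexive indistinguishable_rel.
Proof. by move=> x; apply/asboolP => U _; split. Qed.

Lemma indistinguishable_sym : symmetric indistinguishable_rel.
Proof.
by move=> x y; apply/asboolP/asboolP => h U oU; apply: iff_sym;
  exact: h.
Qed.

Lemma indistinguishable_trans : transitive indistinguishable_rel.
Proof.
move=> y x z /asboolP xy /asboolP yz; apply/asboolP => U oU.
exact: iff_trans (xy U oU) (yz U oU).
Qed.

Canonical indistinguishable_equiv : equiv_rel T :=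
  EquivRel indistinguishable_rel indistinguishable_refl indistinguishable_sym
    indistinguishable_trans.

Definition kolmogorov_quotient : topologicalType :=
  quotient_topology {eq_quot indistinguishable_equiv}.

Definition kolmogorov_pi (x : T) : kolmogorov_quotient :=
  \pi_(quotient_topology {eq_quot indistinguishable_equiv}) x.

End KolmogorovQuotient.

(* Main.v *)
Require Import Defs.
From HB Require Import structures.
From mathcomp Require Import all_boot all_order all_algebra.
From mathcomp Require Import all_classical all_reals topology.

(** The proof rests on two descriptions of the ball topology of a pseudometric
    [d].  First, a set is open exactly when it contains a ball around each of
    its points ([pseudometric_openP]).  Second, as a consequence, two points
    are topologically indistinguishable exactly when their distance is [0]
    ([indistinguishable_dist0]): a point at positive distance from [x] lies
    outside some ball around [x], while a point at distance [0] lies in all of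
    them, hence in every open set containing [x].

    The second fact makes [d] constant on pairs of classes, so it descends to
    the Kolmogorov quotient; it also makes the descended function separate
    points, the other metric axioms being inherited from [d] on
    representatives.  For the topologies, the first fact applies both upstairs
    and downstairs: since eta is surjective and preserves distances, [U]
    contains a ball around [eta x] exactly when its preimage contains a ball of the same
    radius around [x]. *)

Set Implicit Arguments.
Unset Strict Implicit.
Unset Printing Implicit Defensive.

Import Order.TTheory GRing.Theory Num.Theory.
Local Open Scope classical_set_scope.
Local Open Scope ring_scope.
Local Open Scope quotient_scope.

Lemma pseudometric_openP (R : realType) (X : Type) (d : X -> X -> R)
    (pd : is_pseudometric d) (U : set X) :
  pseudometric_open pd U <->
  forall x, U x -> exists2 r, 0 < r & dball d x r `<=` U.
Proof.
split=> [[D' D'balls <-] x [B D'B Bx]|Uball].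
  have [y [r [_ defB]]] := D'balls B D'B.
  move: D'B Bx; rewrite {}defB => D'B yx.
  (* The largest radius that the triangle inequality guarantees to fit. *)
  exists (r - d y x); first by rewrite subr_gt0.
  move=> z; rewrite /dball /= ltrBrDl => xz; exists (dball d y r) => //.
  exact: le_lt_trans (pseudometric_triangle pd y x z) xz.
exists [set B | dballs d B /\ B `<=` U]; first by move=> B [].
apply/seteqP; split=> [x [B [_ BU] /BU]//|x Ux].
have [r r0 xrU] := Uball x Ux; exists (dball d x r).
  by split=> //; exists x, r.
by rewrite /= /dball /= (pseudometric_xx pd).
Qed.

Lemma dball_pseudometric_open (R : realType) (X : Type) (d : X -> X -> R)
    (pd : is_pseudometric d) (x : X) (r : R) :
  0 < r -> pseudometric_open pd (dball d x r).
Proof.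
move=> r0; exists [set dball d x r]; last by rewrite bigcup_set1.
by move=> _ ->; exists x, r.
Qed.

(** If [d x y > 0], the ball around [x] of radius [d x y] is an open set that
    contains [x] but not [y]; if [d x y = 0], every ball around [x] contains
    [y] and conversely. *)
Lemma indistinguishable_dist0 (R : realType) (X : Type) (d : X -> X -> R)
    (pd : is_pseudometric d) (x y : X) :
  indistinguishable (x : pmspace pd) y <-> d x y = 0.
Proof.
split=> [xy|dxy U oU].
  apply/eqP; rewrite eq_le (pseudometric_ge0 pd) andbT leNgt; apply/negP => dxy0.
  have [+ _] := xy _ (dball_pseudometric_open pd x dxy0).
  by rewrite /dball /= (pseudometric_xx pd) ltxx => /(_ dxy0).
have oP := (pseudometric_openP pd U).1 oU.
split=> [/oP|/oP] [r r0]; apply; rewrite /dball /= ?dxy //.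
by rewrite (pseudometric_sym pd) dxy.
Qed.

(** This is what makes the distance of two classes well defined.  By symmetry it
    suffices to bound [d x y] by [d x' y'], which the triangle inequality does
    along [x], [x'], [y'], [y]. *)
Lemma dist0_congr (R : realType) (X : Type) (d : X -> X -> R)
    (pd : is_pseudometric d) (x x' y y' : X) :
  d x x' = 0 -> d y y' = 0 -> d x y = d x' y'.
Proof.
have dist0_le a a' b b' : d a a' = 0 -> d b b' = 0 -> d a b <= d a' b'.
  move=> aa' bb'; apply: le_trans (pseudometric_triangle pd a a' b) _.
  rewrite aa' add0r; apply: le_trans (pseudometric_triangle pd a' b' b) _.
  by rewrite (pseudometric_sym pd b') bb' addr0.
move=> xx' yy'; apply/eqP; rewrite eq_le !dist0_le //.
  by rewrite (pseudometric_sym pd).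
by rewrite (pseudometric_sym pd).
Qed.

Lemma kolmogorov_pi_eqP (T : topologicalType) (x y : T) :
  kolmogorov_pi x = kolmogorov_pi y <-> indistinguishable x y.
Proof.
split=> [/(@eqquotP _ _ {eq_quot indistinguishable_equiv T})/asboolP//|xy].
exact/(@eqquotP _ _ {eq_quot indistinguishable_equiv T})/asboolP.
Qed.

Lemma kolmogorov_pi_surj (T : topologicalType) (q : kolmogorov_quotient T) :
  exists x, q = kolmogorov_pi x.
Proof. by exists (repr q); rewrite /kolmogorov_pi reprK. Qed.

(** Choosing representatives gives a function at once; that the choice does not
    matter is the content of [quotient_dist_pi]. *)
Definition quotient_dist (R : realType) (X : Type) (d : X -> X -> R)
    (pd : is_pseudometric d) (p q : kolmogorov_quotient (pmspace pd)) : R :=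
  d (repr p) (repr q).

Arguments quotient_dist {R X d} pd p q.

Lemma quotient_dist_pi (R : realType) (X : Type) (d : X -> X -> R)
    (pd : is_pseudometric d) (x y : pmspace pd) :
  quotient_dist pd (kolmogorov_pi x) (kolmogorov_pi y) = d x y.
Proof.
have repr_dist0 (z : pmspace pd) : d (repr (kolmogorov_pi z)) z = 0.
  apply/(indistinguishable_dist0 pd)/kolmogorov_pi_eqP.
  by rewrite {1}/kolmogorov_pi reprK.
exact: (dist0_congr pd).
Qed.

Lemma quotient_dist_metric (R : realType) (X : Type) (d : X -> X -> R)
    (pd : is_pseudometric d) : is_metric (quotient_dist pd).
Proof.
split.
  split=> [p q|p|p q|p q s]; rewrite /quotient_dist.
  - exact: pseudometric_ge0 pd _ _.
  - exact: pseudometric_xx pd _.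
  - exact: pseudometric_sym pd _ _.
  - exact: pseudometric_triangle pd _ _ _.
move=> p q; have [x ->] := kolmogorov_pi_surj p.
have [y ->] := kolmogorov_pi_surj q.
by rewrite quotient_dist_pi => /(indistinguishable_dist0 pd)/kolmogorov_pi_eqP.
Qed.

Lemma quotient_dist_openP (R : realType) (X : Type) (d : X -> X -> R)
    (pd : is_pseudometric d) (pq : is_pseudometric (quotient_dist pd))
    (U : set (kolmogorov_quotient (pmspace pd))) :
  pseudometric_open pq U <-> open U.
Proof.
(* A set of classes is open when its preimage is, by definition. *)
change (pseudometric_open pq U <->
  pseudometric_open pd (@kolmogorov_pi (pmspace pd) @^-1` U)).
apply: iff_trans (pseudometric_openP pq U) _.
apply: iff_sym; apply: iff_trans (pseudometric_openP pd _) _.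
split=> [Uball p|Uball x Ux].
  have [x ->] := kolmogorov_pi_surj p => /Uball[r r0 xrU].
  exists r => // q; have [y ->] := kolmogorov_pi_surj q.
  by rewrite /dball /= quotient_dist_pi => /xrU.
have [r r0 xrU] := Uball _ Ux; exists r => // y xy.
by apply: xrU; rewrite /dball /= quotient_dist_pi.
Qed.

Theorem theorem5p3 (R : realType) (X : Type) (d : X -> X -> R)
    (pd : is_pseudometric d) :
  let Q := kolmogorov_quotient (pmspace pd) in
  let eta : X -> Q := @kolmogorov_pi (pmspace pd) in
  exists (dstar : Q -> Q -> R) (mdstar : is_metric dstar),
    unique (fun f : Q -> Q -> R => forall x y : X, f (eta x) (eta y) = d x y)
      dstar /\
    (forall U : set Q, pseudometric_open (proj1 mdstar) U <-> @open Q U).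
Proof.
move=> Q eta; exists (quotient_dist pd), (quotient_dist_metric pd).
split; last by move=> U; exact: quotient_dist_openP.
split=> [x y|f fE]; first exact: quotient_dist_pi.
apply/funext => p; apply/funext => q.
have [x ->] := kolmogorov_pi_surj p; have [y ->] := kolmogorov_pi_surj q.
by rewrite quotient_dist_pi -fE.
Qed.
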